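(* Let $\omega\in\mathcal{W}_0$ and let $\Omega=\{W^x:x>0\}$, $W^x_j=\exp(\frac1x\varphi^*_\omega(xj))$, be the associated weight matrix; let $\omega_\Omega=\{\omega_{W^x}:x>0\}$ be the matrix of the associated weight functions, and $\Omega^{(2)}=\{W^{x;l}:x,l>0\}$. Then the following are equivalent: (i) $\omega$ satisfies $(\omega_1)$: $\omega(2t)=O(\omega(t))$ as $t\to+\infty$. (ii) $\Omega$ satisfies $(\mathcal{M}_{\{\mathrm{L}\}})$: $\forall C>0\ \forall x>0\ \exists D>0\ \exists y>0\ \forall j\in\mathbb{N}:\ C^jW^x_j\le D\,W^y_j$. (iii) $\omega_\Omega$, $\Omega$ and $\Omega^{(2)}$ satisfy any (one, equivalently each) of the Roumieu-type conditions (R1)-(R8) listed in the context. (iv) $\Omega$ satisfies $(\mathcal{M}_{(\mathrm{L})})$: $\forall C>0\ \forall x>0\ \exists D>0\ \exists y>0\ \forall j\in\mathbb{N}:\ C^jW^y_j\le D\,W^x_j$. (v) $\omega_\Omega$, $\Omega$ and $\Omega^{(2)}$ satisfy any (one, equivalently each) of the Beurling-type conditions (B1)-(B8) listed in the context. So the mixed $(\omega_1)$-conditions of Roumieu type (R2) and/or Beurling type (B2) for $\omega_\Omega$ are equivalent to $(\omega_1)$ for $\omega$.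
   Context: $\mathbb{N}=\{0,1,2,\dots\}$. $\mathcal{W}_0$ is the set of continuous nondecreasing $\omega:[0,\infty)\to[0,\infty)$ with $\omega(t)=0$ for $t\in[0,1]$, $\lim_{t\to\infty}\omega(t)=+\infty$, $\log t=o(\omega(t))$ as $t\to+\infty$, and $\varphi_\omega:t\mapsto\omega(e^t)$ convex on $\mathbb{R}$. For $\omega\in\mathcal{W}_0$, $\varphi^*_\omega(x)=\sup_{y\ge0}\{xy-\varphi_\omega(y)\}$, $x\ge0$. For a sequence $M$ of positive reals with $M_0=1$ and $\lim_j(M_j)^{1/j}=+\infty$, $\omega_M(t)=\sup_{j\in\mathbb{N}}\log(t^j/M_j)$ for $t>0$, $\omega_M(0)=0$. For $x,l>0$: $W^{x;l}_j=\exp(\frac1l\varphi^*_{\omega_{W^x}}(lj))$. Roumieu-type conditions ($x,y$ range over $\mathbb{R}_{>0}$): (R1) $\forall h>1\,\forall x\,\exists y$: $\limsup_{t\to+\infty}\omega_{W^y}(ht)/\omega_{W^x}(t)<+\infty$. (R2) $\forall x\,\exists y$: $\limsup_{t\to+\infty}\omega_{W^y}(2t)/\omega_{W^x}(t)<+\infty$. (R3) $\exists r>1\,\forall x\,\exists y\,\exists L\in\mathbb{N}_{>0}$: $\liminf_{j\to+\infty}\frac{(W^y_{Lj})^{1/(Lj)}}{(W^x_j)^{1/j}}>r$. (R4) $\forall r>1\,\forall x\,\exists y\,\exists L\in\mathbb{N}_{>0}$: $\liminf_{j\to+\infty}\frac{(W^y_{Lj})^{1/(Lj)}}{(W^x_j)^{1/j}}>r$.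 (R5) $\forall x\,\forall C>1\,\exists y\,\exists B>0\,\forall a>0\,\exists D>0\,\forall j\in\mathbb{N}$: $C^jW^{x;a}_j\le DW^{y;Ba}_j$. (R6) $\forall x\,\forall C>1\,\forall a>0\,\exists y\,\exists b>0\,\exists D>0\,\forall j\in\mathbb{N}$: $C^jW^{x;a}_j\le DW^{y;b}_j$. (R7) $\forall r>1\,\forall x\,\exists y\,\exists b>0$: $\liminf_{j\to+\infty,\,j\in\mathbb{N}_{>0}}\frac{\exp(\frac1{bj}\varphi^*_{\omega_{W^y}}(bj))}{\exp(\frac1j\varphi^*_{\omega_{W^x}}(j))}>r$. (R8) The same as (R7) with $j\to+\infty$ through $\mathbb{R}_{>0}$. Beurling-type conditions: (B1) $\forall h>1\,\forall x\,\exists y$: $\limsup_{t\to+\infty}\omega_{W^x}(ht)/\omega_{W^y}(t)<+\infty$. (B2) $\forall x\,\exists y$: $\limsup_{t\to+\infty}\omega_{W^x}(2t)/\omega_{W^y}(t)<+\infty$. (B3) $\exists r>1\,\forall x\,\exists y\,\exists L\in\mathbb{N}_{>0}$: $\liminf_{j\to+\infty}\frac{(W^x_{Lj})^{1/(Lj)}}{(W^y_j)^{1/j}}>r$. (B4) $\forall r>1\,\forall x\,\exists y\,\exists L\in\mathbb{N}_{>0}$: $\liminf_{j\to+\infty}\frac{(W^x_{Lj})^{1/(Lj)}}{(W^y_j)^{1/j}}>r$. (B5) $\forall x\,\forall C>1\,\exists y\,\exists B>0\,\forall a>0\,\exists D>0\,\forall j\in\mathbb{N}$: $C^jW^{y;a/B}_j\le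 DW^{x;a}_j$. (B6) $\forall x\,\forall C>1\,\forall a>0\,\exists y\,\exists b>0\,\exists D>0\,\forall j\in\mathbb{N}$: $C^jW^{y;b}_j\le DW^{x;a}_j$. (B7) $\forall r>1\,\forall x\,\exists y\,\exists b>0$: $\liminf_{j\to+\infty,\,j\in\mathbb{N}_{>0}}\frac{\exp(\frac1j\varphi^*_{\omega_{W^x}}(j))}{\exp(\frac bj\varphi^*_{\omega_{W^y}}(j/b))}>r$. (B8) The same as (B7) with $j\to+\infty$ through $\mathbb{R}_{>0}$. *)

(* Defs.v *)
From HB Require Import structures.
From mathcomp Require Import all_boot all_order all_algebra.
From mathcomp Require Import all_classical all_reals all_analysis.

Set Implicit Arguments.
Unset Strict Implicit.
Unset Printing Implicit Defensive.

Import Order.TTheory GRing.Theory Num.Theory.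
Import numFieldNormedType.Exports.

Local Open Scope classical_set_scope.
Local Open Scope ring_scope.

(* Lets the Landau notations be used at +oo%R. *)
Canonical pinfty_filter_on (R : numFieldType) :=
  FilterType (pinfty_nbhs R) _.

(* A function defined on [0, +oo[ is represented by a function on R whose
   values at negative arguments are never used. *)

Section weight_functions.
Context {R : realType}.
Implicit Types (w : R -> R) (M : nat -> R) (x y l t : R) (j : nat).

Definition phi w : R -> R := fun t => w (expR t).

Record weight_function w : Prop := WeightFunction {
  wf_ge0 : forall t, 0 <= t -> 0 <= w t ;
  wf_continuous : {within `[0, +oo[%classic, continuous w} ;
  wf_nondecreasing : {in `[0, +oo[ &, nondecreasing w} ;
  wf_normalized : forall t, 0 <= t <= 1 -> w t = 0 ;
  wf_cvg_pinfty : w t @[t --> +oo] --> +oo ;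
  wf_ln_littleo : (@ln R : R -> R^o) =o_ (pinfty_nbhs R) (w : R -> R^o) ;
  wf_phi_convex : convex_function (setT : set R^o) (phi w) }.

Definition omega1 w : Prop :=
  ((fun t => w (2 * t)) : R -> R^o) =O_ (pinfty_nbhs R) (w : R -> R^o).

(* The suprema below are taken in R.  They are finite whenever w is a
   weight_function, resp. the sequence M is positive and M j `^ (1 / j)
   tends to +oo. *)

Definition phi_conj w x : R :=
  sup [set x * y - phi w y | y in `[0, +oo[%classic].

Definition assoc_weight M t : R :=
  if 0 < t then sup [set ln (t ^+ j / M j) | j in [set: nat]] else 0.

(* W^x_j *)
Definition weight_matrix w x j : R := expR (x^-1 * phi_conj w (x * j%:R)).

(* omega_{M^x} *)
Definition assoc_weights (M : R -> nat -> R) x : R -> R := assoc_weight (M x).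

(* M^{x;l}_j *)
Definition matrix2 (M : R -> nat -> R) x l j : R :=
  expR (l^-1 * phi_conj (assoc_weight (M x)) (l * j%:R)).

End weight_functions.

(* In the conditions below, M is a weight matrix (M^x)_{x > 0}, w a matrix of
   weight functions (w^x)_{x > 0} and N a doubly indexed matrix
   (M^{x;l})_{x, l > 0}; entries at nonpositive indices are never used.
   The limits superior and inferior are taken in \bar R, and the junk values of
   the quotients at small t or at j = 0 do not affect them. *)

Section moderate_growth.
Context {R : realType}.
Implicit Types (M : R -> nat -> R) (x y C D : R).

Definition M_L_roumieu M : Prop :=
  forall C, 0 < C -> forall x, 0 < x ->
  exists2 D : R, 0 < D & exists2 y : R, 0 < y &
  forall j, C ^+ j * M x j <= D * M y j.

Definition M_L_beurling M : Prop :=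
  forall C, 0 < C -> forall x, 0 < x ->
  exists2 D : R, 0 < D & exists2 y : R, 0 < y &
  forall j, C ^+ j * M y j <= D * M x j.

End moderate_growth.

Section roumieu.
Context {R : realType}.
Implicit Types (w : R -> R -> R) (M : R -> nat -> R) (N : R -> R -> nat -> R).
Implicit Types (x y h r a b B C D : R).

Definition R1 w : Prop :=
  forall h, 1 < h -> forall x, 0 < x -> exists2 y : R, 0 < y &
  (limf_esup (fun t : R => (w y (h * t) / w x t)%:E) +oo%R < +oo)%E.

Definition R2 w : Prop :=
  forall x, 0 < x -> exists2 y : R, 0 < y &
  (limf_esup (fun t : R => (w y (2 * t) / w x t)%:E) +oo%R < +oo)%E.

Definition R3 M : Prop :=
  exists2 r : R, 1 < r & forall x, 0 < x -> exists2 y : R, 0 < y &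
  exists2 L : nat, (0 < L)%N &
  (r%:E < limn_einf (fun j : nat =>
    (M y (L * j)%N `^ ((L * j)%:R^-1) / M x j `^ (j%:R^-1))%:E))%E.

Definition R4 M : Prop :=
  forall r, 1 < r -> forall x, 0 < x -> exists2 y : R, 0 < y &
  exists2 L : nat, (0 < L)%N &
  (r%:E < limn_einf (fun j : nat =>
    (M y (L * j)%N `^ ((L * j)%:R^-1) / M x j `^ (j%:R^-1))%:E))%E.

Definition R5 N : Prop :=
  forall x, 0 < x -> forall C, 1 < C -> exists2 y : R, 0 < y &
  exists2 B : R, 0 < B & forall a, 0 < a -> exists2 D : R, 0 < D &
  forall j, C ^+ j * N x a j <= D * N y (B * a) j.

Definition R6 N : Prop :=
  forall x, 0 < x -> forall C, 1 < C -> forall a, 0 < a ->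
  exists2 y : R, 0 < y & exists2 b : R, 0 < b & exists2 D : R, 0 < D &
  forall j, C ^+ j * N x a j <= D * N y b j.

Definition R7 w : Prop :=
  forall r, 1 < r -> forall x, 0 < x -> exists2 y : R, 0 < y &
  exists2 b : R, 0 < b &
  (r%:E < limn_einf (fun j : nat =>
    (expR ((b * j%:R)^-1 * phi_conj (w y) (b * j%:R))
     / expR (j%:R^-1 * phi_conj (w x) j%:R))%:E))%E.

Definition R8 w : Prop :=
  forall r, 1 < r -> forall x, 0 < x -> exists2 y : R, 0 < y &
  exists2 b : R, 0 < b &
  (r%:E < limf_einf (fun u : R =>
    (expR ((b * u)^-1 * phi_conj (w y) (b * u))
     / expR (u^-1 * phi_conj (w x) u))%:E) +oo%R)%E.

End roumieu.

Section beurling.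
Context {R : realType}.
Implicit Types (w : R -> R -> R) (M : R -> nat -> R) (N : R -> R -> nat -> R).
Implicit Types (x y h r a b B C D : R).

Definition B1 w : Prop :=
  forall h, 1 < h -> forall x, 0 < x -> exists2 y : R, 0 < y &
  (limf_esup (fun t : R => (w x (h * t) / w y t)%:E) +oo%R < +oo)%E.

Definition B2 w : Prop :=
  forall x, 0 < x -> exists2 y : R, 0 < y &
  (limf_esup (fun t : R => (w x (2 * t) / w y t)%:E) +oo%R < +oo)%E.

Definition B3 M : Prop :=
  exists2 r : R, 1 < r & forall x, 0 < x -> exists2 y : R, 0 < y &
  exists2 L : nat, (0 < L)%N &
  (r%:E < limn_einf (fun j : nat =>
    (M x (L * j)%N `^ ((L * j)%:R^-1) / M y j `^ (j%:R^-1))%:E))%E.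

Definition B4 M : Prop :=
  forall r, 1 < r -> forall x, 0 < x -> exists2 y : R, 0 < y &
  exists2 L : nat, (0 < L)%N &
  (r%:E < limn_einf (fun j : nat =>
    (M x (L * j)%N `^ ((L * j)%:R^-1) / M y j `^ (j%:R^-1))%:E))%E.

Definition B5 N : Prop :=
  forall x, 0 < x -> forall C, 1 < C -> exists2 y : R, 0 < y &
  exists2 B : R, 0 < B & forall a, 0 < a -> exists2 D : R, 0 < D &
  forall j, C ^+ j * N y (a / B) j <= D * N x a j.

Definition B6 N : Prop :=
  forall x, 0 < x -> forall C, 1 < C -> forall a, 0 < a ->
  exists2 y : R, 0 < y & exists2 b : R, 0 < b & exists2 D : R, 0 < D &
  forall j, C ^+ j * N y b j <= D * N x a j.

Definition B7 w : Prop :=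
  forall r, 1 < r -> forall x, 0 < x -> exists2 y : R, 0 < y &
  exists2 b : R, 0 < b &
  (r%:E < limn_einf (fun j : nat =>
    (expR (j%:R^-1 * phi_conj (w x) j%:R)
     / expR (b / j%:R * phi_conj (w y) (j%:R / b)))%:E))%E.

Definition B8 w : Prop :=
  forall r, 1 < r -> forall x, 0 < x -> exists2 y : R, 0 < y &
  exists2 b : R, 0 < b &
  (r%:E < limf_einf (fun u : R =>
    (expR (u^-1 * phi_conj (w x) u)
     / expR (b / u * phi_conj (w y) (u / b)))%:E) +oo%R)%E.

End beurling.

(* Main.v *)
(* Put f(y) = w(e^y) and let F = f^* be its Young conjugate; F(s) / s is
   nondecreasing.  Replacing a real s / x by its integer part costs only a
   factor 2, so f <= 2 x f_x + D and x f_x <= f, where f_x is the associated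
   weight of W^x in the exponential variable; conjugating,
     F(x t) / x <= (f_x)^*(t) <= F(2 x t) / (2 x) + D.
   Since f is convex it agrees with its biconjugate, and (omega_1), that is
   f(y + h) = O(f(y)) for one or all h > 0, becomes under conjugation
     h t + K F(t / K) <= F(t) + D   (one or all h > 0, some K and D).
   Up to the bounds above, each of the growth conditions on W^x and W^{x;l}
   is this inequality at the points of an arithmetic progression, and the
   monotonicity of F(s) / s passes from the progression to all t; the quotient
   conditions on the associated weights are (omega_1) itself. *)
Require Import Defs.
From mathcomp Require Import all_boot all_order all_algebra.
From mathcomp Require Import all_classical all_reals all_analysis.
From mathcomp Require Import ring lra.

Set Implicit Arguments.
Unset Strict Implicit.
Unset Printing Implicit Defensive.

Import Order.TTheory GRing.Theory Num.Theory.
Import numFieldNormedType.Exports.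

Local Open Scope classical_set_scope.
Local Open Scope ring_scope.

(** * Passing between exponential inequalities and their logarithms *)

Section exponentials.
Context {R : realType}.
Implicit Types (A B C D d r t : R) (j : nat).

(** Lets a threshold for t serve unchanged as a threshold for y = ln t. *)
Lemma lt_expR r t : r <= t -> r < expR t.
Proof. by move=> rt; apply: lt_le_trans (expR_ge1Dx t); lra. Qed.

Lemma le_expM C j A B D : 0 < C -> 0 < D ->
  (C ^+ j * expR A <= D * expR B) = (ln C * j%:R + A <= B + ln D).
Proof.
move=> C0 D0; rewrite -[RHS]ler_expR !expRD [expR B * _]mulrC (lnK D0).
by rewrite expRM_natr lnK.
Qed.

Lemma expR_powR A r : expR A `^ r = expR (r * A).
Proof. by rewrite /powR gt_eqF ?expR_gt0// expRK. Qed.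

(** Once D <= t / 2 the exponent is at least r - 1/2, and e^s >= 1 + s gives r + 1/2. Slope r,
    rather than ln r, thus leaves the margin that a strict limit inferior needs. *)
Lemma le_expR_ratio r D t A B : 0 < t -> 2 * D <= t ->
  r * t + A <= B + D -> r + 2^-1 <= expR (t^-1 * B) / expR (t^-1 * A).
Proof.
move=> t0 Dt gap; rewrite -expRB -mulrBr.
apply: le_trans (expR_ge1Dx _).
have : r - 2^-1 <= t^-1 * (B - A) by rewrite ler_pdivlMl//; lra.
lra.
Qed.

Lemma ge_expR_ratio r t A B : 0 < r -> 0 < t ->
  r <= expR (t^-1 * B) / expR (t^-1 * A) -> ln r * t + A <= B.
Proof.
move=> r0 t0; rewrite -expRB -mulrBr -{1}(lnK r0) ler_expR ler_pdivlMl//; lra.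
Qed.

End exponentials.

(** * Young conjugates on the half-line *)

Section conjugate.
Context {R : realType}.
Implicit Types (w : R -> R) (s c y B : R).

(** The supremum is taken in R and is meaningful only for sets bounded above; this predicate
    supplies the bound. *)
Definition phi_conj_finite w : Prop :=
  forall s, exists B, forall y, 0 <= y -> s * y - phi w y <= B.

Lemma phi_conj_ge w s y : phi_conj_finite w -> 0 <= y ->
  s * y - phi w y <= phi_conj w s.
Proof.
move=> /(_ s)[B hB] y0; apply: ub_le_sup.
  by exists B => _ [z /= + <-]; rewrite in_itv/= andbT; exact: hB.
by exists y => //=; rewrite in_itv/= y0.
Qed.

Lemma phi_conj_le w s B : (forall y, 0 <= y -> s * y - phi w y <= B) ->
  phi_conj w s <= B.
Proof.
move=> hB; apply: ge_sup.
  by exists (s * 0 - phi w 0), 0 => //=; rewrite in_itv/= lexx.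
by move=> _ [z /= + <-]; rewrite in_itv/= andbT; exact: hB.
Qed.

(** Termwise c s y - f(y) <= c (s y - f(y)), because f >= 0 and c <= 1. This is the monotonicity of
    F(s) / s, written without division. *)
Lemma phi_conj_scale w s c : phi_conj_finite w ->
  (forall y, 0 <= y -> 0 <= phi w y) -> 0 <= c <= 1 ->
  phi_conj w (c * s) <= c * phi_conj w s.
Proof.
move=> wfin w0 /andP[c0 c1]; apply: phi_conj_le => y y0.
have := ler_wpM2l c0 (phi_conj_ge s wfin y0).
have := ler_wpM2r (w0 _ y0) c1.
lra.
Qed.

End conjugate.

(** * Convexity and biconjugation of a weight function in the exponential variable *)

Section weight.
Context {R : realType} (w : R -> R) (hw : weight_function w).
Implicit Types (s u x y h t K D U : R).

Lemma phi_ge0 y : 0 <= phi w y.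
Proof. exact/(wf_ge0 hw)/expR_ge0. Qed.

Lemma le_phi : {homo phi w : x y / x <= y}.
Proof.
move=> x y xy; apply: (wf_nondecreasing hw);
  by rewrite ?in_itv/= ?andbT ?expR_ge0 // ler_expR.
Qed.

Lemma phi0 : phi w 0 = 0.
Proof. by rewrite /phi expR0 (wf_normalized hw)// ler01 lexx. Qed.

(** The little-o condition with constant 1 / (|s| + 1), read at t = e^y. *)
Lemma phi_superlinear s : exists U, forall y, U <= y -> s * y <= phi w y.
Proof.
have s1 : 0 < `|s| + 1 by rewrite ltr_wpDl.
have := wf_ln_littleo hw.
move=> /eqoP/(_ (`|s| + 1)^-1); rewrite invr_gt0 => /(_ s1)[T [_ hT]].
exists (Num.max 0 T) => y.
rewrite ge_max => /andP[y0 yT].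
have := hT (expR y) (lt_expR yT); rewrite /= expRK.
rewrite -/(phi w y) (ger0_norm y0) (ger0_norm (phi_ge0 y)).
rewrite ler_pdivlMl// => /(le_trans _); apply.
by apply: ler_wpM2r => //; rewrite (le_trans (ler_norm _))// lerDl.
Qed.

Lemma phi_conj_finite_weight : phi_conj_finite w.
Proof.
move=> s; have [U hU] := phi_superlinear s.
exists (`|s| * `|U|) => y y0; have [Uy|yU] := leP U y.
  by rewrite (@le_trans _ _ 0) ?mulr_ge0// subr_le0 hU.
rewrite (@le_trans _ _ (s * y))// ?gerBl ?phi_ge0//.
rewrite (le_trans (ler_norm _))// normrM ler_wpM2l// ger0_norm//.
by rewrite (le_trans (ltW yU))// ler_norm.
Qed.

Lemma phi_convex x u y : x < u -> u < y ->
  (y - x) * phi w u <= (y - u) * phi w x + (u - x) * phi w y.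
Proof.
move=> xu uy; have xy : 0 < y - x by lra.
have t01 : 0 <= (y - u) / (y - x) <= 1.
  by rewrite divr_ge0 ?(ltW xy)//= ?ler_pdivrMr//; lra.
pose t := @Itv01 R _ (andP t01).1 (andP t01).2.
have := wf_phi_convex hw t (mem_setT x) (mem_setT y).
rewrite !convRE /= /unstable.onem.
have tu : (y - u) / (y - x) * x + (1 - (y - u) / (y - x)) * y = u :> R.
  by field; lra.
rewrite [X in phi w X <= _](_ : _ = u); last exact: tu.
move/(ler_wpM2l (ltW xy)); congr (_ <= _).
by field; lra.
Qed.

(** The slope is the supremum of the left difference quotients at u; convexity bounds each of them
    by every right difference quotient. *)
Lemma subgradient u : exists s, forall y, phi w u + s * (y - u) <= phi w y.
Proof.
pose A := [set (phi w u - phi w y) / (u - y) | y in [set y | y < u]].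
have ubA z : u < z -> ubound A ((phi w z - phi w u) / (z - u)).
  move=> uz _ [y /= yu <-]; have cvx := phi_convex yu uz.
  rewrite ler_pdivrMr ?subr_gt0// mulrAC ler_pdivlMr ?subr_gt0//; lra.
exists (sup A) => y; have [yu|uy|->] := ltgtP y u.
- have : (phi w u - phi w y) / (u - y) <= sup A.
    apply: ub_le_sup; last by exists y.
    by exists ((phi w (u + 1) - phi w u) / (u + 1 - u)); apply: ubA; lra.
  rewrite ler_pdivrMr ?subr_gt0//; lra.
- have : sup A <= (phi w y - phi w u) / (y - u).
    apply: ge_sup; last exact: ubA.
    by exists ((phi w u - phi w (u - 1)) / (u - (u - 1))), (u - 1) => //=; lra.
  by rewrite ler_pdivlMr ?subr_gt0//; lra.
- by rewrite subrr mulr0 addr0.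
Qed.

(** At a subgradient s the supremum defining F(s) is attained at u, so f(u) is recovered from F;
    comparing with the point 0, where f vanishes, gives f(u) <= s u. *)
Lemma phi_biconj u : 0 <= u ->
  exists2 s, 0 <= s & phi_conj w s <= s * u - phi w u /\ phi w u <= s * u.
Proof.
move=> u0; have [s hs] := subgradient u; exists s; last first.
  split; first by apply: phi_conj_le => y _; have := hs y; lra.
  by have := hs 0; rewrite phi0; lra.
(* A negative slope would give f(u - 1) > f(u), against monotonicity. *)
rewrite leNgt; apply/negP => s0.
have := hs (u - 1); have := @le_phi (u - 1) u; lra.
Qed.

(** * The weight matrix, its associated weights and their conjugates *)

Definition scaled_conj x t := x^-1 * phi_conj w (x * t).

(** With [scaled_conj_le], this shows that [scaled_conj x] is the conjugate of f / x. At integers it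
    is ln W^x_j, and it extends this to real arguments. *)
Lemma scaled_conj_ge x t y : 0 < x -> 0 <= y ->
  t * y - x^-1 * phi w y <= scaled_conj x t.
Proof.
move=> x0 y0; have := phi_conj_ge (x * t) phi_conj_finite_weight y0.
by rewrite -(@ler_pM2l _ x^-1) ?invr_gt0// mulrBr -mulrA mulKf ?gt_eqF.
Qed.

Lemma scaled_conj_le x t B : 0 < x ->
  (forall y, 0 <= y -> t * y - x^-1 * phi w y <= B) -> scaled_conj x t <= B.
Proof.
move=> x0 hB; rewrite ler_pdivrMl//; apply: phi_conj_le => y y0.
rewrite -(@ler_pM2l _ x^-1) ?invr_gt0// mulrBr -mulrA !mulKf ?gt_eqF//.
exact: hB.
Qed.

Lemma assoc_weight_ge x u j : 0 < x -> 0 <= u ->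
  j%:R * u - scaled_conj x j%:R <= phi (assoc_weight (weight_matrix w x)) u.
Proof.
move=> x0 u0; rewrite /phi /assoc_weight expR_gt0.
apply: ub_le_sup; last first.
  by exists j => //; rewrite /weight_matrix -expRM_natl -expRB expRK.
exists (x^-1 * phi w u) => _ [k _ <-].
rewrite /weight_matrix -expRM_natl -expRB expRK.
by have := scaled_conj_ge k%:R x0 u0; rewrite /scaled_conj; lra.
Qed.

Lemma assoc_weight_le x u : 0 < x -> 0 <= u ->
  phi (assoc_weight (weight_matrix w x)) u <= x^-1 * phi w u.
Proof.
move=> x0 u0; rewrite /phi /assoc_weight expR_gt0.
apply: ge_sup; first by eexists; exists 0%N.
move=> _ [k _ <-]; rewrite /weight_matrix -expRM_natl -expRB expRK.
by have := scaled_conj_ge k%:R x0 u0; rewrite /scaled_conj /phi; lra.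
Qed.

Lemma phi_conj_weight0 : phi_conj w 0 <= 0.
Proof. by apply: phi_conj_le => y _; rewrite mul0r sub0r oppr_le0 phi_ge0. Qed.

Lemma phi_assoc_weight_ge0 x u : 0 < x -> 0 <= u ->
  0 <= phi (assoc_weight (weight_matrix w x)) u.
Proof.
move=> x0 u0; apply: le_trans (assoc_weight_ge 0 x0 u0).
rewrite mul0r sub0r oppr_ge0 /scaled_conj mulr0 pmulr_rle0 ?invr_gt0//.
exact: phi_conj_weight0.
Qed.

Lemma assoc_weight_equiv x : 0 < x -> exists2 D, 0 <= D & forall u, 0 <= u ->
  phi w u <= 2 * x * phi (assoc_weight (weight_matrix w x)) u + D.
Proof.
move=> x0; have D0 : 0 <= phi_conj w x.
  by have := phi_conj_ge x phi_conj_finite_weight (lexx 0); rewrite phi0; lra.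
exists (phi_conj w x) => // u u0; have v0 := phi_assoc_weight_ge0 x0 u0.
set v := phi _ u in v0 *.
have [s s0 [conj_s phi_s]] := phi_biconj u0.
have xv j : x * j%:R * u - phi_conj w (x * j%:R) <= x * v.
  have := assoc_weight_ge j x0 u0; rewrite -(ler_pM2l x0).
  by rewrite /scaled_conj mulrBr mulVKf ?gt_eqF// mulrA.
(* If s < x, the term j = 1 suffices: f(u) <= s u <= x u, and F(x) is the additive constant. *)
have [j0|j0] := leqP (Num.trunc (s / x)) 0.
  have sx : s < x.
    have := truncnS_gt (s / x); move: j0; rewrite leqn0 => /eqP ->.
    by rewrite ltr_pdivrMr// mul1r.
  have := xv 1%N; rewrite mulr1; have := ler_wpM2r u0 (ltW sx).
  have : 0 <= x * v by rewrite mulr_ge0// ltW.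
  lra.
(* Otherwise x j <= s < x (j + 1) <= 2 x j. Monotonicity of F(s) / s gives x j u - F(x j) >= (x j /
   s) (s u - F(s)), and x j / s >= 1/2. *)
set j := Num.trunc _ in j0.
have /andP[js sj] : j%:R <= s / x < j.+1%:R.
  by rewrite truncn_itv// divr_ge0// ltW.
have {}j0 : 1 <= j%:R :> R by rewrite ler1n.
have xj0 : 0 < x * j%:R by rewrite mulr_gt0//; lra.
move: js sj; rewrite ler_pdivlMr// ltr_pdivrMr// -natr1 => js sj.
have spos : 0 < s by rewrite mulrC in xj0; lra.
have c01 : 0 <= x * j%:R / s <= 1.
  by rewrite divr_ge0 ?(ltW xj0)//= ler_pdivrMr// mul1r mulrC.
have := phi_conj_scale s phi_conj_finite_weight (fun y _ => phi_ge0 y) c01.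
rewrite divfK ?gt_eqF// => /(ler_wpM2l s0).
rewrite mulrA mulrCA mulfV ?gt_eqF// mulr1 => le1.
have le2 := ler_wpM2l s0 (xv j).
have le3 := ler_wpM2l (ltW xj0) conj_s.
have le4 : s * (x * v) <= 2 * (x * j%:R) * (x * v).
  rewrite ler_wpM2r ?mulr_ge0 ?(ltW x0)//.
  have := ler_wpM2l (ltW x0) j0; lra.
have : phi w u <= 2 * x * v by rewrite -(ler_pM2l xj0); lra.
lra.
Qed.

Definition assoc_conj x t := phi_conj (assoc_weight (weight_matrix w x)) t.

Lemma assoc_conj_bounds x : 0 < x ->
  exists2 D, 0 <= D & forall t, 0 <= t ->
  scaled_conj x t <= assoc_conj x t <= scaled_conj (2 * x) t + D.
Proof.
move=> x0; have [D D0 hD] := assoc_weight_equiv x0.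
have x20 : 0 < 2 * x by lra.
exists ((2 * x)^-1 * D); first by rewrite mulr_ge0// invr_ge0 ltW.
rewrite /assoc_conj; set v := assoc_weight _.
have ub t y : 0 <= y ->
    t * y - phi v y <= scaled_conj (2 * x) t + (2 * x)^-1 * D.
  move=> y0; have := hD y y0.
  rewrite -/v -(ler_pM2l (_ : 0 < (2 * x)^-1)) ?invr_gt0//.
  rewrite mulrDr mulKf ?gt_eqF//.
  have := scaled_conj_ge t x20 y0; lra.
move=> t t0; apply/andP; split; last exact/phi_conj_le/ub.
apply: scaled_conj_le => // y y0.
(* The upper bound just proved also makes the conjugate of the associated weight a genuine
   supremum. *)
have fv : phi_conj_finite v by move=> s; eexists => y' y'0; exact: ub.
by apply: le_trans (phi_conj_ge t fv y0); rewrite lerB// assoc_weight_le.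
Qed.

(** * The condition (omega_1) and its conjugate form *)

Lemma phi_shift d K U : 0 < d -> 0 < K ->
  (forall u, U <= u -> phi w (u + d) <= K * phi w u) ->
  forall h, exists2 K', 0 < K' &
  forall u, U <= u -> phi w (u + h) <= K' * phi w u.
Proof.
move=> d0 K0 hd h.
have iter n u : U <= u -> phi w (u + n%:R * d) <= K ^+ n * phi w u.
  move=> Uu; elim: n => [|n IHn]; first by rewrite mul0r addr0 mul1r.
  rewrite -natr1 mulrDl mul1r addrA (le_trans (hd _ _))//.
    by rewrite (le_trans Uu)// lerDl mulr_ge0// ltW.
  by rewrite exprS -mulrA ler_pM2l.
(* This many shifts by d exceed h, and monotonicity of f does the rest. *)
exists (K ^+ (Num.trunc (h / d)).+1) => [|u Uu]; first exact: exprn_gt0.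
apply: le_trans (iter _ _ Uu); apply: le_phi; rewrite lerD2l ltW//.
by rewrite -ltr_pdivrMr// truncnS_gt.
Qed.

Lemma omega1_phi : omega1 w <->
  exists2 K, 0 < K &
  exists U, forall u, U <= u -> phi w (u + ln 2) <= K * phi w u.
Proof.
have exp2 u : expR (u + ln 2) = 2 * expR u by rewrite expRD lnK ?posrE// mulrC.
split=> [/eqO_exP[K K0 [T [_ hT]]]|[K K0 [U hU]]].
  exists K => //; exists T => u Tu.
  have := hT (expR u) (lt_expR Tu); rewrite /= -exp2 -![w (expR _)]/(phi w _).
  by rewrite !ger0_norm ?phi_ge0.
apply/eqO_exP; exists K => //; exists (expR U); split; first exact: num_real.
move=> t /= Ut; have t0 : 0 < t by apply: lt_trans Ut; exact: expR_gt0.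
rewrite -[t]lnK ?posrE// -exp2 -![w (expR _)]/(phi w _).
by rewrite !ger0_norm ?phi_ge0// hU// ltW// -ltr_expR lnK ?posrE.
Qed.

Lemma omega1_conj : omega1 w -> forall h, 0 <= h -> exists2 K, 0 < K &
  exists D, forall s, s * h + K * phi_conj w (K^-1 * s) <= phi_conj w s + D.
Proof.
move=> /omega1_phi[K0 K00 [U hU]] h h0.
have [K Kpos hK] := phi_shift (@ln_gt0 R 2 (ltr1n _ _)) K00 hU h.
exists K => //; exists (phi w (U + h)) => s.
(* An additive constant absorbs the range u < U, so the bound holds for all u and can be
   conjugated. *)
have {}hK u : phi w (u + h) <= K * phi w u + phi w (U + h).
  have [Uu|uU] := leP U u.
    by rewrite (le_trans (hK u Uu))// lerDl phi_ge0.
  rewrite (@le_trans _ _ (phi w (U + h)))//.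
    by rewrite le_phi// lerD2r ltW.
  by rewrite lerDr mulr_ge0 ?phi_ge0 ?ltW.
suff : phi_conj w (K^-1 * s) <= K^-1 * (phi_conj w s + phi w (U + h) - s * h).
  by rewrite -(ler_pM2l Kpos) mulVKf ?gt_eqF//; lra.
(* Testing F(s) at y + h instead of y produces the linear term s h. *)
apply: phi_conj_le => y y0.
rewrite -(ler_pM2l Kpos) mulVKf ?gt_eqF// mulrBr -mulrA mulVKf ?gt_eqF//.
have := hK y; have := phi_conj_ge s phi_conj_finite_weight (addr_ge0 y0 h0).
lra.
Qed.

(** Put s = K x t in the conjugate inequality and divide by K x. The factor K is chosen before x;
    this uniformity is what later allows x to be replaced by x / K in the Beurling case. *)
Lemma omega1_scaled_conj : omega1 w -> forall h, 0 <= h -> exists2 K, 0 < K &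
  forall x, 0 < x -> exists D, forall t,
  h * t + scaled_conj x t <= scaled_conj (K * x) t + D.
Proof.
move=> w1 h h0; have [K K0 [D hD]] := omega1_conj w1 h0; exists K => // x x0.
have Kx0 : 0 < K * x by rewrite mulr_gt0.
exists ((K * x)^-1 * D) => t; rewrite /scaled_conj -mulrDr ler_pdivlMl//.
have := hD (K * x * t); rewrite -!mulrA mulKf ?gt_eqF//.
rewrite !mulrDr [x * (x^-1 * _)]mulVKf ?gt_eqF//; lra.
Qed.

Lemma omega1_of_conj d c S : 0 < d -> 0 < c ->
  (forall s, S <= s -> d * s + scaled_conj c s <= phi_conj w s) -> omega1 w.
Proof.
move=> d0 c0 hS; apply/omega1_phi.
have [U hU] := phi_superlinear 1.
pose U' := Num.max d U; pose K := c^-1 + 2 * `|S|.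
have K0 : 0 < K by rewrite ltr_wpDr ?invr_gt0// mulr_ge0.
have hK u : U' <= u -> phi w (u + d) <= K * phi w u.
  rewrite ge_max => /andP[du Uu].
  have ud0 : 0 <= u + d by lra.
  have [s s0 [conj_s phi_s]] := phi_biconj ud0.
  (* Slopes s >= S use the hypothesis: f(u + d) <= s (u + d) - F(s) <= s u - [scaled_conj c s] <=
     f(u) / c. Slopes s < S use f(u + d) <= s (u + d) <= 2 |S| u <= 2 |S| f(u). *)
  rewrite /K mulrDl; have [Ss|sS] := leP S s.
    rewrite ler_wpDr ?mulr_ge0 ?phi_ge0//.
    have := hS s Ss; have := scaled_conj_ge s c0 (_ : 0 <= u).
    by move=> /(_ ltac:(lra)); lra.
  rewrite ler_wpDl ?mulr_ge0 ?phi_ge0 ?invr_ge0 ?(ltW c0)//.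
  have := hU u Uu; rewrite mul1r => u_le.
  have := ler_wpM2l (normr_ge0 S) u_le.
  have := ler_wpM2r ud0 (le_trans (ltW sS) (ler_norm S)).
  have := ler_wpM2l (normr_ge0 S) du.
  lra.
have [K' K'0 hK'] := phi_shift d0 K0 hK (ln 2).
by exists K' => //; exists U'.
Qed.

Lemma omega1_of_scaled_conj a b h D (N : nat) : 0 < a -> 0 < b -> 0 < h ->
  (forall j, (N <= j)%N ->
    h * j%:R + scaled_conj a j%:R <= scaled_conj b j%:R + D) -> omega1 w.
Proof.
move=> a0 b0 h0 hN.
(* With j the integer part of s / b, the first bound gives 2 |D| <= h j, so that D costs only half
   of h. The second gives j >= N + 1 >= 1, hence b j <= s <= 2 b j. *)
pose S := Num.max (4 * b * `|D| / h) (b * N.+1%:R).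
have c0 : 0 < a / (2 * b) by rewrite divr_gt0// mulr_gt0.
apply: (@omega1_of_conj (h / 2) (a / (2 * b)) S) => //.
  by rewrite divr_gt0.
move=> s; rewrite ge_max => /andP[sD sN].
have s0 : 0 < s by apply: lt_le_trans sN; rewrite mulr_gt0.
have sb0 : 0 <= s / b by rewrite divr_ge0 // ltW.
have jN : (N.+1 <= Num.trunc (s / b))%N.
  by rewrite truncn_ge_nat// ler_pdivlMr// mulrC.
have /andP[] := truncn_itv sb0.
set j := Num.trunc _ in jN *.
rewrite ler_pdivlMr// ltr_pdivrMr// -natr1 [j%:R * b]mulrC => js sj.
have j1 : 1 <= j%:R :> R by rewrite ler1n (leq_trans _ jN).
have j0 : 0 < j%:R :> R by lra.
have sj2 : s <= 2 * b * j%:R by have := ler_wpM2l (ltW b0) j1; lra.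
have scale c t : 0 < t -> 0 <= c <= t ->
    t * phi_conj w c <= c * phi_conj w t.
  move=> t0 /andP[cc0 ct].
  have c01 : 0 <= c / t <= 1.
    by rewrite divr_ge0 ?(ltW t0)//= ler_pdivrMr// mul1r.
  have := phi_conj_scale t phi_conj_finite_weight (fun y _ => phi_ge0 y) c01.
  by rewrite divfK ?gt_eqF// mulrAC ler_pdivlMr// mulrC.
(* Monotonicity of F(s) / s between b j and s; next, between c s and a j with c = a / (2 b), whose
   factor 2 compensates for s <= 2 b j. *)
have e1 : s * scaled_conj b j%:R <= j%:R * phi_conj w s.
  have := scale (b * j%:R) s s0; rewrite mulr_ge0 ?(ltW b0)//= => /(_ js).
  by rewrite /scaled_conj mulrCA ler_pdivrMl// mulrA.
have e2 : j%:R * scaled_conj (a / (2 * b)) s <= s * scaled_conj a j%:R.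
  have c_le : a / (2 * b) * s <= a * j%:R.
    by rewrite mulrAC ler_pdivrMr ?mulr_gt0// -mulrA ler_pM2l//; lra.
  have := scale (a / (2 * b) * s) (a * j%:R).
  rewrite mulr_gt0// c_le mulr_ge0 ?(ltW c0) ?(ltW s0)//= => /(_ isT isT).
  rewrite -(@ler_pM2l _ (a^-1 / (a / (2 * b)))).
    2: by rewrite divr_gt0 ?invr_gt0.
  rewrite /scaled_conj; congr (_ <= _); field; rewrite ?gt_eqF//.
have Dj : 2 * `|D| <= h * j%:R.
  move: sD; rewrite ler_pdivrMr// => sD.
  rewrite -(@ler_pM2l _ (2 * b)) ?mulr_gt0//.
  have := ler_wpM2r (ltW h0) sj2; lra.
rewrite -(ler_pM2l j0).
have := ler_wpM2l (ltW s0) (hN j (ltnW jN)).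
have := ler_wpM2l (ltW s0) Dj; have := ler_wpM2l (ltW s0) (ler_norm D).
lra.
Qed.

Lemma omega1_gap : omega1 w -> forall h, 0 <= h -> exists2 K, 0 < K &
  forall x, 0 < x -> exists D, forall t, 0 <= t ->
  h * t + assoc_conj x t <= assoc_conj (K * x) t + D.
Proof.
move=> w1 h h0; have [K K0 hK] := omega1_scaled_conj w1 h0.
(* The factor 2 comes from the upper bound of [assoc_conj x] by [scaled_conj (2 * x)]. *)
exists (K * 2) => [|x x0]; first by rewrite mulr_gt0.
have [D hD] := hK _ (mulr_gt0 (ltr0n R 2) x0).
have [D1 _ hD1] := assoc_conj_bounds x0.
have [D2 _ hD2] := assoc_conj_bounds (mulr_gt0 (mulr_gt0 K0 (ltr0n R 2)) x0).
exists (D + D1) => t t0.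
have /andP[_ h1] := hD1 t t0; have /andP[h2 _] := hD2 t t0.
have := hD t; rewrite mulrA; move: h1 h2.
move: (scaled_conj _ _) (scaled_conj _ _) (assoc_conj _ _) (assoc_conj _ _).
move=> A B A' B'; lra.
Qed.

Lemma omega1_of_gap x y a b h D (N : nat) :
  0 < x -> 0 < y -> 0 < a -> 0 < b -> 0 < h ->
  (forall j, (N <= j)%N ->
    h * j%:R + a^-1 * assoc_conj x (a * j%:R) <=
    b^-1 * assoc_conj y (b * j%:R) + D) -> omega1 w.
Proof.
move=> x0 y0 a0 b0 h0 hN.
have [D1 _ hD1] := assoc_conj_bounds x0.
have [D2 _ hD2] := assoc_conj_bounds y0.
(* The scales a and b are absorbed into the matrix index. *)
have scaleM u c t : c^-1 * scaled_conj u (c * t) = scaled_conj (u * c) t.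
  by rewrite /scaled_conj mulrA -invfM mulrA [c * u]mulrC.
apply: (@omega1_of_scaled_conj (x * a) (2 * y * b) h (D + b^-1 * D2) N);
  rewrite ?mulr_gt0//.
move=> j jN; rewrite -(scaleM x) -(scaleM (2 * y)).
have aj0 : 0 <= a * j%:R by rewrite mulr_ge0 ?(ltW a0).
have bj0 : 0 <= b * j%:R by rewrite mulr_ge0 ?(ltW b0).
have /andP[+ _] := hD1 _ aj0; have /andP[_ +] := hD2 _ bj0.
rewrite -(ler_pM2l (_ : 0 < b^-1)) ?invr_gt0// => h2.
rewrite -(ler_pM2l (_ : 0 < a^-1)) ?invr_gt0// => h1.
have := hN j jN; move: h1 h2.
move: (scaled_conj _ _) (scaled_conj _ _) (assoc_conj _ _) (assoc_conj _ _).
move=> A B A' B'; lra.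
Qed.

(** * Quotients of associated weights *)

Lemma phi_unbounded B : exists U, forall u, U <= u -> B <= phi w u.
Proof.
have [U hU] := phi_superlinear 1; exists (Num.max U B) => u.
by rewrite ge_max => /andP[/hU + Bu]; rewrite mul1r; exact: le_trans.
Qed.

(** The associated weight is equivalent to f / x up to a constant, so each single one inherits
    (omega_1); the index does not change. *)
Lemma omega1_assoc_weight : omega1 w -> forall h x, 0 < h -> 0 < x ->
  exists K, \forall t \near +oo,
    assoc_weight (weight_matrix w x) (h * t) /
    assoc_weight (weight_matrix w x) t <= K.
Proof.
move=> /omega1_phi[K0 K00 [U0 hU0]] h x h0 x0.
have [K Kpos hK] := phi_shift (@ln_gt0 R 2 (ltr1n _ _)) K00 hU0 (ln h).
have [D D0 hD] := assoc_weight_equiv x0.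
(* Then D <= f(u) / 2, so f(u) <= 4 x v(u) with v(u) > 0. The threshold |ln h| below keeps u + ln h
   nonnegative. *)
have [U hU] := phi_unbounded (2 * D + 1).
exists (4 * K); exists (expR (Num.max (Num.max U0 U) `|ln h|)).
split=> [|t /=]; first exact: num_real.
move=> tU; have t0 : 0 < t by apply: lt_trans tU; exact: expR_gt0.
move: tU; rewrite -[t]lnK ?posrE// ltr_expR => /ltW; set u := ln t.
rewrite !ge_max -andbA => /and3P[U0u Uu hu].
have u0 : 0 <= u by exact: le_trans hu.
have hu0 : 0 <= u + ln h by have := ler_norm (- ln h); rewrite normrN; lra.
have -> : h * expR u = expR (u + ln h) by rewrite expRD lnK ?posrE// mulrC.
have h1 := assoc_weight_le x0 hu0; have h2 := hD u u0.
have h3 := hU u Uu; have h4 := hK u U0u.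
rewrite -![assoc_weight _ (expR _)]/(phi _ _).
set v := phi (assoc_weight _) in h1 h2 *.
have v0 : 0 < v u by rewrite -(pmulr_rgt0 _ (_ : 0 < 2 * x)); lra.
rewrite ler_pdivrMr// (le_trans h1)// ler_pdivrMl// (le_trans h4)//.
have : phi w u <= 4 * (x * v u) by lra.
by move=> /(ler_wpM2l (ltW Kpos)); lra.
Qed.

Lemma omega1_of_assoc_weight x y : 0 < x -> 0 < y ->
  (exists K, \forall t \near +oo,
    assoc_weight (weight_matrix w y) (2 * t) /
    assoc_weight (weight_matrix w x) t <= K) -> omega1 w.
Proof.
move=> x0 y0 [K [T [_ hT]]]; apply/omega1_phi.
have [Dx Dx0 hDx] := assoc_weight_equiv x0.
have [Dy Dy0 hDy] := assoc_weight_equiv y0.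
(* This makes the denominator positive and lets f(u) absorb Dy, the source of the summand 1 in the
   constant. *)
have [U hU] := phi_unbounded (Dx + Dy + 1).
exists (2 * y * `|K| * x^-1 + 1).
  by rewrite ltr_wpDl// !mulr_ge0// ?invr_ge0 ltW.
exists (Num.max (Num.max 0 U) T) => u.
rewrite !ge_max -andbA => /and3P[u0 Uu Tu].
have u20 : 0 <= u + ln 2 by rewrite addr_ge0// ln_ge0// ler1n.
have := hT _ (lt_expR Tu); rewrite /=.
have <- : expR (u + ln 2) = 2 * expR u by rewrite expRD lnK ?posrE// mulrC.
rewrite -![assoc_weight _ (expR _)]/(phi _ _).
have h1 := assoc_weight_le x0 u0; have h2 := hDx u u0; have h3 := hDy _ u20.
have h4 := hU u Uu.
set vx := phi (assoc_weight _) u in h1 h2 *.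
set vy := phi (assoc_weight _) (u + _) in h3 *.
have vx0 : 0 < vx by rewrite -(pmulr_rgt0 _ (_ : 0 < 2 * x)); lra.
rewrite ler_pdivrMr// => h5.
have h6 : vy <= `|K| * (x^-1 * phi w u).
  apply: (le_trans h5); apply: (@le_trans _ _ (`|K| * vx)).
    by rewrite ler_pM2r// ler_norm.
  by rewrite ler_wpM2l.
have := ler_wpM2l (ltW y0) h6; lra.
Qed.

End weight.

(** * Limits superior and inferior as eventual bounds *)

Section limf.
Context {R : realType} {T : choiceType} {X : filteredType T}.
Context (F : set_system X) {FF : ProperFilter F}.
Implicit Types (f : X -> R) (r : R).

Lemma limf_esup_lty f :
  (limf_esup (fun x => (f x)%:E) F < +oo)%E <->
  exists K, \forall x \near F, f x <= K.
Proof.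
split=> [|[K hK]].
  move=> /ereal_inf_lt[_ [A FA <-]] supA.
  have /filter_ex[x0 Ax0] := FA.
  have fA x : A x -> ((f x)%:E <= ereal_sup [set (f x)%:E | x in A])%E.
    by move=> Ax; apply: ereal_sup_ubound; exists x.
  (* A point of A rules out the value -oo, so the supremum is a real number. *)
  have := fA x0 Ax0; move: supA fA.
  case: (ereal_sup _) => // K _ fA _.
  by exists K; apply: filterS FA => x /fA; rewrite lee_fin.
apply: (@le_lt_trans _ _ K%:E); last exact: ltry.
apply: (@le_trans _ _ (ereal_sup [set (f x)%:E | x in [set x | f x <= K]])).
  by apply: ereal_inf_lbound; exists [set x | f x <= K].
by apply: ge_ereal_sup => _ [x /= fx <-]; rewrite lee_fin.
Qed.

Lemma lt_limf_einf f r : (r%:E < limf_einf (fun x => (f x)%:E) F)%E ->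
  \forall x \near F, r < f x.
Proof.
rewrite limf_einfE => /ereal_sup_gt[_ [A FA <-]] infA.
apply: filterS FA => x Ax; rewrite -lte_fin; apply: lt_le_trans infA _.
by apply: ereal_inf_lbound; exists x.
Qed.

Lemma limf_einf_gt f r r' : r < r' -> (\forall x \near F, r' <= f x) ->
  (r%:E < limf_einf (fun x => (f x)%:E) F)%E.
Proof.
move=> rr' hf; apply: (@lt_le_trans _ _ r'%:E); first by rewrite lte_fin.
rewrite limf_einfE.
apply: (@le_trans _ _ (ereal_inf [set (f x)%:E | x in [set x | r' <= f x]])).
  by apply: le_ereal_inf_tmp => _ [x /= fx <-]; rewrite lee_fin.
by apply: ereal_sup_ubound; exists [set x | r' <= f x].
Qed.

End limf.

(** * Each growth condition compared with (omega_1) *)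

Section conditions.
Context {R : realType} (w : R -> R) (hw : weight_function w).
Local Notation Omega := (weight_matrix w).
Local Notation omega_Omega := (assoc_weights Omega).
Implicit Types (x y h r a b C D t : R) (j : nat).

(** Taking the (L j)-th root at L j multiplies the index by L. At j = 0 both sides equal 1, since
    the inverse of 0 is 0. *)
Lemma root_weight_matrix x (L : nat) j : (0 < L)%N ->
  Omega x (L * j)%N `^ (L * j)%:R^-1 =
  expR (j%:R^-1 * scaled_conj w (x * L%:R) j%:R).
Proof.
move=> L0; rewrite expR_powR /scaled_conj natrM [x * (_ * _)]mulrA !invfM.
by rewrite [L%:R^-1 * _]mulrC !mulrA [_ / x]mulrAC.
Qed.

Lemma root_weight_matrix1 x j :
  Omega x j `^ j%:R^-1 = expR (j%:R^-1 * scaled_conj w x j%:R).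
Proof. by rewrite expR_powR. Qed.

Lemma omega1_M_L_roumieu : omega1 w <-> M_L_roumieu Omega.
Proof.
split=> [w1 C C0 x x0|/(_ _ (expR_gt0 1) 1 ltr01)[D D0 [y y0 hD]]].
  have [K K0 /(_ x x0)[D hD]] := omega1_scaled_conj hw w1 (normr_ge0 (ln C)).
  exists (expR D); first exact: expR_gt0.
  exists (K * x) => [|j]; first exact: mulr_gt0.
  rewrite le_expM ?expR_gt0// expRK.
  by apply: le_trans (hD j%:R); rewrite lerD2r ler_wpM2r// ler_norm.
(* The choice C = e makes the slope ln C equal to 1. *)
apply: (@omega1_of_scaled_conj _ w hw 1 y 1 (ln D) 0) => // j _.
by have := hD j; rewrite le_expM ?expR_gt0// expRK.
Qed.

Lemma omega1_scaled_conj_beurling : omega1 w -> forall h, 0 <= h ->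
  forall x, 0 < x -> exists2 y, 0 < y & exists D, forall t,
  h * t + scaled_conj w y t <= scaled_conj w x t + D.
Proof.
move=> w1 h h0 x x0; have [K K0 hK] := omega1_scaled_conj hw w1 h0.
have y0 : 0 < K^-1 * x by rewrite mulr_gt0 ?invr_gt0.
exists (K^-1 * x) => //; have [D hD] := hK _ y0.
by exists D => t; have := hD t; rewrite mulVKf ?gt_eqF.
Qed.

Lemma omega1_M_L_beurling : omega1 w <-> M_L_beurling Omega.
Proof.
split=> [w1 C C0 x x0|/(_ _ (expR_gt0 1) 1 ltr01)[D D0 [y y0 hD]]].
  have [y y0 [D hD]] := omega1_scaled_conj_beurling w1 (normr_ge0 (ln C)) x0.
  exists (expR D); first exact: expR_gt0.
  exists y => // j; rewrite le_expM ?expR_gt0// expRK.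
  by apply: le_trans (hD j%:R); rewrite lerD2r ler_wpM2r// ler_norm.
apply: (@omega1_of_scaled_conj _ w hw y 1 1 (ln D) 0) => // j _.
by have := hD j; rewrite le_expM ?expR_gt0// expRK.
Qed.

Lemma omega1_R1 : omega1 w -> R1 omega_Omega.
Proof.
move=> w1 h h1 x x0; exists x => //; apply/limf_esup_lty.
by apply: omega1_assoc_weight => //; lra.
Qed.

Lemma R1_R2 : R1 omega_Omega -> R2 omega_Omega.
Proof. by apply; rewrite ltr1n. Qed.

Lemma R2_omega1 : R2 omega_Omega -> omega1 w.
Proof.
move=> /(_ 1 ltr01)[y y0 /limf_esup_lty]; exact: omega1_of_assoc_weight.
Qed.

Lemma omega1_B1 : omega1 w -> B1 omega_Omega.
Proof.
move=> w1 h h1 x x0; exists x => //; apply/limf_esup_lty.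
by apply: omega1_assoc_weight => //; lra.
Qed.

Lemma B1_B2 : B1 omega_Omega -> B2 omega_Omega.
Proof. by apply; rewrite ltr1n. Qed.

Lemma B2_omega1 : B2 omega_Omega -> omega1 w.
Proof.
move=> /(_ 1 ltr01)[y y0 /limf_esup_lty]; exact: omega1_of_assoc_weight.
Qed.

Lemma near_expR_ratio r D (A B : R -> R) :
  (forall t, 0 <= t -> r * t + A t <= B t + D) ->
  \forall t \near +oo, r + 2^-1 <= expR (t^-1 * B t) / expR (t^-1 * A t).
Proof.
move=> gap; near=> t; apply: (@le_expR_ratio _ _ D).
- by near: t; exact/nbhs_pinfty_gt/num_real.
- by near: t; exact/nbhs_pinfty_ge/num_real.
- by apply: gap; near: t; exact/nbhs_pinfty_ge/num_real.
Unshelve. all: by end_near. Qed.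

Lemma near_nat (P : set R) : (\forall t \near +oo, P t) ->
  \forall j \near \oo, P j%:R.
Proof. exact: (@cvgr_idn R). Qed.

Lemma omega1_of_near_ratio x y a b r :
  0 < x -> 0 < y -> 0 < a -> 0 < b -> 1 < r ->
  (\forall j \near \oo,
     r < expR (j%:R^-1 * (b^-1 * assoc_conj w y (b * j%:R)))
         / expR (j%:R^-1 * (a^-1 * assoc_conj w x (a * j%:R)))) ->
  omega1 w.
Proof.
move=> x0 y0 a0 b0 r1 [N _ hN].
(* Starting at N + 1 excludes j = 0, where the j-th root carries no information. *)
apply: (@omega1_of_gap _ w hw x y a b (ln r) 0 N.+1) => //; first exact: ln_gt0.
move=> j jN; rewrite addr0; apply: ge_expR_ratio; first by lra.
  by rewrite ltr0n (leq_trans _ jN).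
by apply/ltW/hN; exact: ltnW.
Qed.

Lemma omega1_of_near_root x y r :
  0 < x -> 0 < y -> 1 < r ->
  (\forall j \near \oo,
     r < expR (j%:R^-1 * scaled_conj w y j%:R)
         / expR (j%:R^-1 * scaled_conj w x j%:R)) ->
  omega1 w.
Proof.
move=> x0 y0 r1 [N _ hN].
apply: (@omega1_of_scaled_conj _ w hw x y (ln r) 0 N.+1) => //.
  exact: ln_gt0.
move=> j jN; rewrite addr0; apply: ge_expR_ratio; first by lra.
  by rewrite ltr0n (leq_trans _ jN).
by apply/ltW/hN; exact: ltnW.
Qed.

Lemma omega1_gap_beurling : omega1 w -> forall h, 0 <= h ->
  forall x, 0 < x -> exists2 y, 0 < y & exists D, forall t, 0 <= t ->
  h * t + assoc_conj w y t <= assoc_conj w x t + D.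
Proof.
move=> w1 h h0 x x0; have [K K0 hK] := omega1_gap hw w1 h0.
have y0 : 0 < K^-1 * x by rewrite mulr_gt0 ?invr_gt0.
exists (K^-1 * x) => //; have [D hD] := hK _ y0.
by exists D => t t0; have := hD t t0; rewrite mulVKf ?gt_eqF.
Qed.

(** * Root conditions on the weight matrix *)

Lemma omega1_R4 : omega1 w -> R4 Omega.
Proof.
move=> w1 r r1 x x0; have r0 : 0 <= r by lra.
have [K K0 /(_ x x0)[D hD]] := omega1_scaled_conj hw w1 r0.
exists (K * x); first exact: mulr_gt0.
(* L = 1 suffices because the whole gain sits in the index K x. *)
exists 1%N => //.
apply: (limf_einf_gt (r' := r + 2^-1)); first by rewrite ltrDl.
have := near_nat (near_expR_ratio (fun t _ => hD t)).
by apply: filterS => j; rewrite root_weight_matrix// root_weight_matrix1 mulr1.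
Qed.

Lemma omega1_B4 : omega1 w -> B4 Omega.
Proof.
move=> w1 r r1 x x0; have r0 : 0 <= r by lra.
have [y y0 [D hD]] := omega1_scaled_conj_beurling w1 r0 x0.
exists y => //.
exists 1%N => //.
apply: (limf_einf_gt (r' := r + 2^-1)); first by rewrite ltrDl.
have := near_nat (near_expR_ratio (fun t _ => hD t)).
by apply: filterS => j; rewrite root_weight_matrix// root_weight_matrix1 mulr1.
Qed.

Lemma R4_R3 : R4 Omega -> R3 Omega.
Proof. by move=> h; exists 2; [rewrite ltr1n|exact/h/ltr1n]. Qed.

Lemma B4_B3 : B4 Omega -> B3 Omega.
Proof. by move=> h; exists 2; [rewrite ltr1n|exact/h/ltr1n]. Qed.

Lemma R3_omega1 : R3 Omega -> omega1 w.
Proof.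
move=> [r r1 /(_ 1 ltr01)[y y0 [L L0 /lt_limf_einf hL]]].
have yL0 : 0 < y * L%:R by rewrite mulr_gt0// ltr0n.
apply: (@omega1_of_near_root 1 (y * L%:R) r) => //.
by apply: filterS hL => j; rewrite root_weight_matrix// root_weight_matrix1.
Qed.

Lemma B3_omega1 : B3 Omega -> omega1 w.
Proof.
move=> [r r1 /(_ 1 ltr01)[y y0 [L L0 /lt_limf_einf hL]]].
have L0' : 0 < 1 * L%:R :> R by rewrite mul1r ltr0n.
apply: (@omega1_of_near_root y (1 * L%:R) r) => //.
by apply: filterS hL => j; rewrite root_weight_matrix// root_weight_matrix1.
Qed.

(** * Conditions on the second matrix *)

Lemma le_matrix2 C x y a b j D : 0 < C -> 0 < D ->
  (C ^+ j * matrix2 Omega x a j <= D * matrix2 Omega y b j) =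
  (ln C * j%:R + a^-1 * assoc_conj w x (a * j%:R) <=
   b^-1 * assoc_conj w y (b * j%:R) + ln D).
Proof. exact: le_expM. Qed.

(** The gap is read at t = a j and divided by a. The constant then depends on a, as the order of
    quantifiers in (R5) and (B5) permits. *)
Lemma le_matrix2_of_gap C x y a D : 1 < C -> 0 < a ->
  (forall t, 0 <= t -> ln C * t + assoc_conj w x t <= assoc_conj w y t + D) ->
  forall j,
  C ^+ j * matrix2 Omega x a j <= expR (a^-1 * D) * matrix2 Omega y a j.
Proof.
move=> C1 a0 hD j; rewrite le_matrix2 ?expR_gt0// ?expRK; last by lra.
have aj0 : 0 <= a * j%:R by rewrite mulr_ge0// ltW.
rewrite -mulrDr ler_pdivlMl// mulrDr mulVKf ?gt_eqF//.
by apply: le_trans (hD _ aj0); rewrite mulrCA.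
Qed.

Lemma omega1_R5 : omega1 w -> R5 (matrix2 Omega).
Proof.
move=> w1 x x0 C C1.
have [K K0 /(_ x x0)[D hD]] := omega1_gap hw w1 (ln_ge0 (ltW C1)).
exists (K * x); first exact: mulr_gt0.
exists 1 => // a a0; exists (expR (a^-1 * D)); first exact: expR_gt0.
by rewrite mul1r; exact: le_matrix2_of_gap.
Qed.

Lemma omega1_B5 : omega1 w -> B5 (matrix2 Omega).
Proof.
move=> w1 x x0 C C1.
have [y y0 [D hD]] := omega1_gap_beurling w1 (ln_ge0 (ltW C1)) x0.
exists y => //.
exists 1 => // a a0; exists (expR (a^-1 * D)); first exact: expR_gt0.
by rewrite divr1; exact: le_matrix2_of_gap.
Qed.

Lemma R5_R6 : R5 (matrix2 Omega) -> R6 (matrix2 Omega).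
Proof.
move=> h x x0 C C1 a a0; have [y y0 [B B0 /(_ a a0)[D D0 hD]]] := h x x0 C C1.
exists y => //; exists (B * a); first exact: mulr_gt0.
by exists D.
Qed.

Lemma B5_B6 : B5 (matrix2 Omega) -> B6 (matrix2 Omega).
Proof.
move=> h x x0 C C1 a a0; have [y y0 [B B0 /(_ a a0)[D D0 hD]]] := h x x0 C C1.
exists y => //; exists (a / B); first exact: divr_gt0.
by exists D.
Qed.

Lemma R6_omega1 : R6 (matrix2 Omega) -> omega1 w.
Proof.
move=> /(_ 1 ltr01 2 (ltr1n _ _) 1 ltr01)[y y0 [b b0 [D D0 hD]]].
apply: (@omega1_of_gap _ w hw 1 y 1 b (ln 2) (ln D) 0) => // [|j _].
  exact/ln_gt0/ltr1n.
by rewrite -le_matrix2.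
Qed.

Lemma B6_omega1 : B6 (matrix2 Omega) -> omega1 w.
Proof.
move=> /(_ 1 ltr01 2 (ltr1n _ _) 1 ltr01)[y y0 [b b0 [D D0 hD]]].
apply: (@omega1_of_gap _ w hw y 1 b 1 (ln 2) (ln D) 0) => // [|j _].
  exact/ln_gt0/ltr1n.
by rewrite -le_matrix2.
Qed.

(** * Conditions on quotients of exponentiated conjugates *)

Lemma omega1_R7 : omega1 w -> R7 omega_Omega.
Proof.
move=> w1 r r1 x x0; have r0 : 0 <= r by lra.
have [K K0 /(_ x x0)[D hD]] := omega1_gap hw w1 r0.
exists (K * x); first exact: mulr_gt0.
exists 1 => //; apply: (limf_einf_gt (r' := r + 2^-1)); first by rewrite ltrDl.
by apply: filterS (near_nat (near_expR_ratio hD)) => j; rewrite mul1r.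
Qed.

Lemma omega1_R8 : omega1 w -> R8 omega_Omega.
Proof.
move=> w1 r r1 x x0; have r0 : 0 <= r by lra.
have [K K0 /(_ x x0)[D hD]] := omega1_gap hw w1 r0.
exists (K * x); first exact: mulr_gt0.
exists 1 => //; apply: (limf_einf_gt (r' := r + 2^-1)); first by rewrite ltrDl.
by apply: filterS (near_expR_ratio hD) => u; rewrite mul1r.
Qed.

Lemma omega1_B7 : omega1 w -> B7 omega_Omega.
Proof.
move=> w1 r r1 x x0; have r0 : 0 <= r by lra.
have [y y0 [D hD]] := omega1_gap_beurling w1 r0 x0; exists y => //.
exists 1 => //; apply: (limf_einf_gt (r' := r + 2^-1)); first by rewrite ltrDl.
by apply: filterS (near_nat (near_expR_ratio hD)) => j; rewrite mul1r divr1.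
Qed.

Lemma omega1_B8 : omega1 w -> B8 omega_Omega.
Proof.
move=> w1 r r1 x x0; have r0 : 0 <= r by lra.
have [y y0 [D hD]] := omega1_gap_beurling w1 r0 x0; exists y => //.
exists 1 => //; apply: (limf_einf_gt (r' := r + 2^-1)); first by rewrite ltrDl.
by apply: filterS (near_expR_ratio hD) => u; rewrite mul1r divr1.
Qed.

Lemma R8_R7 : R8 omega_Omega -> R7 omega_Omega.
Proof.
(* An eventual bound > r would only give a limit inferior >= r; applying the hypothesis to r + 1
   keeps the inequality strict. *)
move=> h r r1 x x0; have r1' : 1 < r + 1 by lra.
have [y y0 [b b0 /lt_limf_einf/near_nat hb]] := h _ r1' x x0.
exists y => //; exists b => //.
apply: (limf_einf_gt (r' := r + 1)); first by lra.
by apply: filterS hb => j /ltW.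
Qed.

Lemma B8_B7 : B8 omega_Omega -> B7 omega_Omega.
Proof.
move=> h r r1 x x0; have r1' : 1 < r + 1 by lra.
have [y y0 [b b0 /lt_limf_einf/near_nat hb]] := h _ r1' x x0.
exists y => //; exists b => //.
apply: (limf_einf_gt (r' := r + 1)); first by lra.
by apply: filterS hb => j /ltW.
Qed.

Lemma R7_omega1 : R7 omega_Omega -> omega1 w.
Proof.
move=> /(_ 2 (ltr1n _ _) 1 ltr01)[y y0 [b b0 /lt_limf_einf hb]].
apply: (@omega1_of_near_ratio 1 y 1 b 2) => //; first exact: ltr1n.
by apply: filterS hb => j; rewrite invr1 !mul1r mulrA -invfM [j%:R * b]mulrC.
Qed.

Lemma B7_omega1 : B7 omega_Omega -> omega1 w.
Proof.
move=> /(_ 2 (ltr1n _ _) 1 ltr01)[y y0 [b b0 /lt_limf_einf hb]].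
(* The Beurling scaling j / b is the scale a = 1 / b. *)
apply: (@omega1_of_near_ratio y 1 b^-1 1 2); rewrite ?invr_gt0//.
  exact: ltr1n.
apply: filterS hb => j.
by rewrite invr1 !mul1r invrK mulrA [j%:R / b]mulrC [b / j%:R]mulrC.
Qed.

End conditions.

Theorem corollary3p3 (R : realType) (w : R -> R) (hw : weight_function w) :
  let Omega := weight_matrix w in
  let omega_Omega := assoc_weights Omega in
  let Omega2 := matrix2 Omega in
  [<-> omega1 w;
       M_L_roumieu Omega;
       R1 omega_Omega; R2 omega_Omega; R3 Omega; R4 Omega;
       R5 Omega2; R6 Omega2; R7 omega_Omega; R8 omega_Omega;
       M_L_beurling Omega;
       B1 omega_Omega; B2 omega_Omega; B3 Omega; B4 Omega;
       B5 Omega2; B6 Omega2; B7 omega_Omega; B8 omega_Omega].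
Proof.
(* The implications form a cycle in the order of the list; where two neighbours are not directly
   comparable, the step passes through (omega_1). *)
move=> Omega omega_Omega Omega2; tfae.
- by move/(omega1_M_L_roumieu hw).
- by move/(omega1_M_L_roumieu hw)/(omega1_R1 hw).
- exact: R1_R2.
- by move/(R2_omega1 hw)/(omega1_R4 hw)/R4_R3.
- by move/(R3_omega1 hw)/(omega1_R4 hw).
- by move/R4_R3/(R3_omega1 hw)/(omega1_R5 hw).
- exact: R5_R6.
- by move/(R6_omega1 hw)/(omega1_R7 hw).
- by move/(R7_omega1 hw)/(omega1_R8 hw).
(* Here the cycle crosses from the Roumieu to the Beurling conditions. *)
- by move/R8_R7/(R7_omega1 hw)/(omega1_M_L_beurling hw).
- by move/(omega1_M_L_beurling hw)/(omega1_B1 hw).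
- exact: B1_B2.
- by move/(B2_omega1 hw)/(omega1_B4 hw)/B4_B3.
- by move/(B3_omega1 hw)/(omega1_B4 hw).
- by move/B4_B3/(B3_omega1 hw)/(omega1_B5 hw).
- exact: B5_B6.
- by move/(B6_omega1 hw)/(omega1_B7 hw).
- by move/(B7_omega1 hw)/(omega1_B8 hw).
- by move/B8_B7/(B7_omega1 hw).
Qed.
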